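(* Let $G$ be a connected graph of order $n$ with $m$ edges, maximum degree $\Delta$, minimum non-pendent vertex degree $\delta_1$, and $p$ pendent vertices. Then \[ AG(G) \ge \frac{p(\delta_1+1)}{2\sqrt{\delta_1}} + \frac{\sqrt{2(m-p)(\Delta+\delta_1)\sqrt{\Delta\delta_1}}}{\Delta\left(\Delta+\delta_1+2\sqrt{\Delta\delta_1}\right)}\sqrt{F + 2m\Delta^2 - p(3\Delta^2+1)}, \] with equality if and only if $G$ is isomorphic to $K_{1,n-1}$, or $G$ is a regular graph, or $G$ is a $(\Delta,1)$-semiregular graph.
   Context: All graphs are finite, simple and undirected. $d_i$ is the degree of vertex $v_i$; $i\sim j$ denotes an edge $v_iv_j$ and sums over $i\sim j$ run over edges, each once. A pendent vertex is a vertex of degree $1$; $p$ is the number of pendent vertices; $\delta_1$ is the minimum degree among non-pendent vertices. $AG(G)=\sum_{i\sim j}\frac12\left(\sqrt{d_i/d_j}+\sqrt{d_j/d_i}\right)$, $F(G)=\sum_i d_i^3=\sum_{i\sim j}(d_i^2+d_j^2)$. A graph is $(s,r)$-semiregular if its vertex set is the disjoint union of two nonempty sets $V_1,V_2$ with all vertices of $V_1$ of degree $s$ and all vertices of $V_2$ of degree $r$. $K_{1,n-1}$ is the star. *)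

(* Defs.v *)
From HB Require Import structures.
From mathcomp Require Import all_boot all_order all_algebra.

Set Implicit Arguments.
Unset Strict Implicit.
Unset Printing Implicit Defensive.

Import Order.TTheory GRing.Theory Num.Theory.

Record sgraph := SGraph {
  vertex :> finType;
  adj : rel vertex;
  adj_sym : symmetric adj;
  adj_irrefl : irreflexive adj }.

Definition connected (G : sgraph) : Prop :=
  0 < #|G| /\ forall x y : G, connect (@adj G) x y.

(* Each undirected edge is represented exactly once, by its ordered pair of
   ends whose first component comes first in the enumeration of vertices. *)
Definition edges (G : sgraph) : {set G * G} :=
  [set u | adj u.1 u.2 & enum_rank u.1 < enum_rank u.2].

Definition deg (G : sgraph) (v : G) : nat := #|[set w | adj v w]|.

Definition max_deg (G : sgraph) : nat := \max_(v : G) deg v.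

Definition pendent (G : sgraph) (v : G) : bool := deg v == 1.

Definition nb_pendent (G : sgraph) : nat := #|[set v : G | pendent v]|.

(* Every degree is smaller than #|G|, so the default value #|G| is attained
   only when all vertices are pendent. *)
Definition min_nonpendent_deg (G : sgraph) : nat :=
  \big[minn/#|G|]_(v : G | ~~ pendent v) deg v.

Definition forgotten_index (G : sgraph) : nat := \sum_(v : G) deg v ^ 3.

Definition regular (G : sgraph) : Prop := exists k, forall v : G, deg v = k.

(* The parts V1 and V2 need not be independent sets. *)
Definition semiregular (s r : nat) (G : sgraph) : Prop :=
  exists V1 V2 : {set G},
    [/\ V1 :|: V2 = [set: G], [disjoint V1 & V2], V1 != set0 & V2 != set0] /\
    (forall v, v \in V1 -> deg v = s) /\ (forall v, v \in V2 -> deg v = r).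

Definition isomorphic (G H : sgraph) : Prop :=
  exists2 f : G -> H, bijective f & forall x y, adj (f x) (f y) = adj x y.

Definition star_adj (n : nat) : rel 'I_n :=
  fun i j => (i == 0 :> nat) != (j == 0 :> nat).

Lemma star_adj_sym n : symmetric (@star_adj n).
Proof. by move=> i j; rewrite /star_adj eq_sym. Qed.

Lemma star_adj_irrefl n : irreflexive (@star_adj n).
Proof. by move=> i; rewrite /star_adj eqxx. Qed.

(* The star K_{1,n-1} on n vertices, centred at 0. *)
Definition star (n : nat) : sgraph :=
  SGraph (@star_adj_sym n) (@star_adj_irrefl n).

Local Open Scope ring_scope.

Definition AG (R : rcfType) (G : sgraph) : R :=
  \sum_(u in edges G)
    2^-1 * (Num.sqrt ((deg u.1)%:R / (deg u.2)%:R)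
            + Num.sqrt ((deg u.2)%:R / (deg u.1)%:R)).

(* Main.v *)
(* Write h(x) = (x + 1) / (2 sqrt x). A pendent edge contributes at least
   h(delta1) to AG(G), any other edge at least 1, so
   AG(G) >= p h(delta1) + (m - p). Bounding d^3 by d Delta^2 at the non-pendent
   vertices gives F + 2 m Delta^2 - p (3 Delta^2 + 1) <= 4 Delta^2 (m - p), so by
   AM-GM for Delta + delta1 and 2 sqrt(Delta delta1) the second summand of the
   bound is at most m - p. If m > p, the equality case of AM-GM forces
   Delta = delta1; if m = p, every non-pendent vertex lies on a pendent edge and
   strict monotonicity of h on [1, oo) does so. Hence equality means that all
   non-pendent vertices have degree Delta. *)

Require Import Defs.
From HB Require Import structures.
From mathcomp Require Import all_boot all_order all_algebra.
From mathcomp Require Import ring lra.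

Set Implicit Arguments.
Unset Strict Implicit.
Unset Printing Implicit Defensive.

Import Order.TTheory GRing.Theory Num.Theory.
Local Open Scope ring_scope.


(** * Real inequalities for edge weights and for the second summand of the bound *)

Section RealInequalities.

Variable R : rcfType.
Implicit Types a b c d e s t x y K M D : R.

Definition edge_weight d e : R := 2^-1 * (Num.sqrt (d / e) + Num.sqrt (e / d)).

(** This is h: the weight of an edge joining a vertex of degree [d] to a pendent one, see
    [edge_weight1]. *)
Definition pendent_weight d : R := (d + 1) / (2 * Num.sqrt d).

Lemma edge_weightC d e : edge_weight d e = edge_weight e d.
Proof. by rewrite /edge_weight addrC. Qed.

Lemma edge_weight_ge1 d e : 0 < d -> 0 < e -> 1 <= edge_weight d e.
Proof.
move=> d_gt0 e_gt0; rewrite /edge_weight -[e / d]invf_div sqrtrV; last by rewrite divr_ge0 ?ltW.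
have: 0 < Num.sqrt (d / e) by rewrite sqrtr_gt0 divr_gt0.
move: (Num.sqrt _) => s s_gt0.
have -> : 2^-1 * (s + s^-1) = 1 + (s - 1) ^+ 2 / (2 * s) by field; rewrite lt0r_neq0.
by rewrite lerDl divr_ge0 ?sqr_ge0 // mulr_ge0 ?ltW.
Qed.

Lemma edge_weight_diag d : 0 < d -> edge_weight d d = 1.
Proof. by move=> d_gt0; rewrite /edge_weight divff ?lt0r_neq0 // sqrtr1; field. Qed.

Lemma edge_weight1 d : 0 < d -> edge_weight d 1 = pendent_weight d.
Proof.
move=> d_gt0; rewrite /edge_weight /pendent_weight divr1 div1r sqrtrV ?ltW //.
rewrite -{3}(sqr_sqrtr (ltW d_gt0)).
by field; rewrite lt0r_neq0 ?sqrtr_gt0.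
Qed.

(** With t = sqrt d and s = sqrt e, cross-multiplying leaves 2 (s - t) (s t - 1), which is positive
    because 1 <= t < s. *)
Lemma pendent_weight_lt d e : 1 <= d -> d < e -> pendent_weight d < pendent_weight e.
Proof.
move=> d_ge1 lt_de; rewrite /pendent_weight.
have d_ge0 : 0 <= d by lra.
have e_ge0 : 0 <= e by lra.
have t_ge1 : 1 <= Num.sqrt d by rewrite -[1]sqrtr1 ler_wsqrtr.
have lt_ts : Num.sqrt d < Num.sqrt e by rewrite ltr_sqrt //; lra.
rewrite -{1}(sqr_sqrtr d_ge0) -{1}(sqr_sqrtr e_ge0).
move: (Num.sqrt d) (Num.sqrt e) t_ge1 lt_ts => t s t_ge1 lt_ts.
rewrite ltr_pdivrMr; last lra.
rewrite -mulrAC ltr_pdivlMr; [|lra].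
rewrite -subr_gt0.
have -> : (s ^+ 2 + 1) * (2 * t) - (t ^+ 2 + 1) * (2 * s) = 2 * ((s - t) * (s * t - 1)) by ring.
rewrite !mulr_gt0 //; first by lra.
nra.
Qed.

Lemma pendent_weight_le d e : 1 <= d -> d <= e -> pendent_weight d <= pendent_weight e.
Proof.
move=> d_ge1; rewrite le_eqVlt => /predU1P[-> // | lt_de].
exact/ltW/pendent_weight_lt.
Qed.

(** The second summand of the bound, with [M] for m - p and [K] for the last radicand. Keeping [K]
    free allows it to be raised to 4 D^2 M. *)
Definition core_bound D d M K : R :=
  Num.sqrt (2 * M * (D + d) * Num.sqrt (D * d))
    / (D * (D + d + 2 * Num.sqrt (D * d))) * Num.sqrt K.

Lemma AGM_sqrt a b : 0 <= a -> 0 <= b -> 2 * Num.sqrt (a * b) <= a + b ?= iff (a == b).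
Proof.
move=> a_ge0 b_ge0; rewrite sqrtrM //.
rewrite -{2 3}(sqr_sqrtr a_ge0) -{2 3}(sqr_sqrtr b_ge0).
rewrite eqrXn2 ?sqrtr_ge0 //.
move: (Num.sqrt a) (Num.sqrt b) => s t; split.
  by rewrite -subr_ge0 (_ : _ - _ = (s - t) ^+ 2) ?sqr_ge0 //; ring.
by rewrite eq_sym -subr_eq0 (_ : _ - _ = (s - t) ^+ 2) ?sqrf_eq0 ?subr_eq0 //; ring.
Qed.

(** At this value of [K] the factor D cancels, leaving [M] times the ratio of the geometric to the
    arithmetic mean of D + d and 2 sqrt (D d). *)
Lemma core_bound_max D d M : 0 < D -> 0 <= d -> 0 <= M ->
  core_bound D d M (4 * D ^+ 2 * M)
  = M * (2 * Num.sqrt ((D + d) * (2 * Num.sqrt (D * d)))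
         / (D + d + 2 * Num.sqrt (D * d))).
Proof.
move=> D_gt0 d_ge0 M_ge0; rewrite /core_bound.
have b_ge0 : 0 <= Num.sqrt (D * d) by apply: sqrtr_ge0.
move: (Num.sqrt (D * d)) b_ge0 => b b_ge0.
have -> : 2 * M * (D + d) * b = M * ((D + d) * (2 * b)) by ring.
have -> : 4 * D ^+ 2 * M = (2 * D) ^+ 2 * M by ring.
rewrite (sqrtrM _ M_ge0) (sqrtrM _ (sqr_ge0 _)) sqrtr_sqr ger0_norm; last by lra.
rewrite -{3}(sqr_sqrtr M_ge0).
by field; rewrite !lt0r_neq0 //; lra.
Qed.

Lemma core_bound_le_max D d M K : 0 < D -> 0 <= d -> K <= 4 * D ^+ 2 * M ->
  core_bound D d M K <= core_bound D d M (4 * D ^+ 2 * M).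
Proof.
move=> D_gt0 d_ge0 leK; apply: ler_wpM2l; last exact: ler_wsqrtr.
rewrite divr_ge0 ?sqrtr_ge0 // mulr_ge0 ?ltW //.
by have := sqrtr_ge0 (D * d); lra.
Qed.

Lemma core_bound_le D d M K : 0 < D -> 0 <= d -> 0 <= M -> K <= 4 * D ^+ 2 * M ->
  core_bound D d M K <= M.
Proof.
move=> D_gt0 d_ge0 M_ge0 leK; apply: le_trans (core_bound_le_max D_gt0 d_ge0 leK) _.
rewrite core_bound_max // ler_piMr //.
have b_ge0 := sqrtr_ge0 (D * d).
rewrite ler_pdivrMr ?mul1r; last by lra.
by apply: (AGM_sqrt _ _).1; lra.
Qed.

(** As [M] is positive, the ratio of means is at least 1, so AM-GM is an equality: D + d = 2 sqrt (D
    d), that is (sqrt D - sqrt d)^2 = 0. *)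
Lemma core_bound_eq D d M K : 0 < D -> 0 <= d -> 0 < M -> K <= 4 * D ^+ 2 * M ->
  core_bound D d M K = M -> d = D.
Proof.
move=> D_gt0 d_ge0 M_gt0 leK eqM.
have := core_bound_le_max D_gt0 d_ge0 leK.
have b_ge0 := sqrtr_ge0 (D * d).
rewrite eqM core_bound_max ?(ltW M_gt0) // ler_pMr // ler_pdivlMr ?mul1r; last by lra.
have D2_ge0 : 0 <= D + d by lra.
have b2_ge0 : 0 <= 2 * Num.sqrt (D * d) by lra.
rewrite (ge_leif (AGM_sqrt D2_ge0 b2_ge0)) => /eqP.
rewrite sqrtrM ?(ltW D_gt0) // => eqDd.
have D_ge0 := ltW D_gt0.
rewrite -{1}(sqr_sqrtr D_ge0) -{1}(sqr_sqrtr d_ge0) in eqDd.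
rewrite -(sqr_sqrtr D_ge0) -(sqr_sqrtr d_ge0).
move: (Num.sqrt D) (Num.sqrt d) eqDd => x y eqxy.
suff /eqP : (x - y) ^+ 2 = 0 by rewrite sqrf_eq0 subr_eq0 => /eqP ->.
have -> : (x - y) ^+ 2 = x ^+ 2 + y ^+ 2 - 2 * (x * y) by ring.
by rewrite eqxy subrr.
Qed.

Lemma core_bound_diag D M : 0 < D -> 0 <= M ->
  core_bound D D M (4 * D ^+ 2 * M) = M.
Proof.
move=> D_gt0 M_ge0; rewrite core_bound_max ?(ltW D_gt0) //.
have -> : Num.sqrt (D * D) = D by rewrite -expr2 sqrtr_sqr gtr0_norm.
have -> : (D + D) * (2 * D) = (2 * D) ^+ 2 by ring.
rewrite sqrtr_sqr gtr0_norm; last by lra.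
by field; rewrite lt0r_neq0 //; lra.
Qed.

End RealInequalities.

(** * Double counting over edges, extremal degrees, and pendent vertices of a connected graph *)

Section Graphs.

Variable G : sgraph.
Implicit Types v w : G.

Lemma sum_edges (V : nmodType) (f : G -> V) :
  \sum_(u in edges G) (f u.1 + f u.2) = \sum_(v : G) f v *+ deg v.
Proof.
have swapK : involutive (fun u : G * G => (u.2, u.1)) by case.
(* Swapping the ends turns the sum of [f u.2] into one of [f u.1] over adjacent pairs of decreasing
   rank. The two sums together run over all ordered adjacent pairs. *)
rewrite big_split /= [X in _ + X](reindex_inj (inv_inj swapK)) /=.
have -> : \sum_(v : G) f v *+ deg v = \sum_(u : G * G | adj u.1 u.2) f u.1.
  rewrite -(pair_big_dep predT (fun v w => adj v w) (fun v _ => f v)) /=.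
  by apply: eq_bigr => v _; rewrite sumr_const /deg cardsE.
rewrite [RHS](bigID (fun u => enum_rank u.1 < enum_rank u.2)%N) /=; congr (_ + _).
  by apply: eq_bigl => u; rewrite inE.
apply: eq_bigl => -[v w]; rewrite !inE /= adj_sym -leqNgt.
case vw: (adj v w) => //=; rewrite ltn_neqAle.
have [/ord_inj/enum_rank_inj vEw|//] := eqVneq (val (enum_rank w)) (val (enum_rank v)).
by rewrite vEw adj_irrefl in vw.
Qed.

Lemma mem_edges v w : adj v w -> ((v, w) \in edges G) || ((w, v) \in edges G).
Proof.
move=> vw; rewrite !inE /= vw adj_sym vw /= -neq_ltn.
apply: contraTneq vw => /ord_inj/enum_rank_inj ->.
by rewrite adj_irrefl.
Qed.

Lemma deg_gt0P v : reflect (exists w, adj v w) (0 < deg v)%N.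
Proof.
by apply: (iffP card_gt0P) => -[w vw]; exists w; rewrite inE in vw *.
Qed.

Lemma deg_le_max v : (deg v <= max_deg G)%N.
Proof. exact: leq_bigmax. Qed.

Lemma min_nonpendent_deg_le v : ~~ pendent v -> (min_nonpendent_deg G <= deg v)%N.
Proof.
move=> np; rewrite /min_nonpendent_deg.
elim: (index_enum G) (mem_index_enum v) => // x s IHs; rewrite inE big_cons.
case/predU1P => [<-|/IHs le_s]; first by rewrite np geq_minl.
by case: ifP => _ //; rewrite geq_min le_s orbT.
Qed.

Lemma min_nonpendent_deg_attained :
  (exists v : G, ~~ pendent v) -> exists2 v : G, ~~ pendent v & deg v = min_nonpendent_deg G.
Proof.
case=> v0 np0.
case: (@arg_minnP _ v0 (fun v : G => ~~ pendent v) (@deg G) np0) => v np minv; exists v => //.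
apply/eqP; rewrite eqn_leq min_nonpendent_deg_le // andbT /min_nonpendent_deg.
elim/big_ind: _ => [|x y lex ley|i npi]; last exact: minv.
  (* The default value [#|G|] does no harm, since it is at least every degree. *)
  exact: max_card.
by rewrite leq_min lex.
Qed.

Hypothesis Gconn : connected G.

Lemma deg_gt0 v : (0 < max_deg G)%N -> (0 < deg v)%N.
Proof.
move=> max_gt0; case: Gconn => G_gt0 conn.
have [w maxw] := @bigop.eq_bigmax G (@deg G) G_gt0.
(* A path from [v] to a vertex of maximum degree is either empty, so that [v] has maximum degree, or
   starts with an edge at [v]. *)
have /connectP[[|x q] /= pathq lastq] := conn v w.
  by rewrite -lastq -maxw.
by case/andP: pathq => vx _; apply/deg_gt0P; exists x.
Qed.

Lemma pendent_neighbour v w u : pendent v -> adj v w -> adj v u -> u = w.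
Proof.
move=> /cards1P[z Ez] vw vu.
have : w \in [set z] by rewrite -Ez inE.
have : u \in [set z] by rewrite -Ez inE.
by rewrite !inE => /eqP-> /eqP->.
Qed.

Hypothesis Gnonpendent : exists v : G, ~~ pendent v.

(** Two adjacent pendent vertices form a connected component, hence the whole graph, which leaves no
    room for a non-pendent vertex. *)
Lemma adj_not_both_pendent v w : adj v w -> pendent v -> ~~ pendent w.
Proof.
move=> vw pv; apply/negP => pw; case: Gnonpendent => x /negP[].
have wv : adj w v by rewrite adj_sym.
have clos : closed (@adj G) (pred2 v w).
  apply: intro_closed => [|a b ab /pred2P[] Ea]; first exact/sym_connect_sym/adj_sym.
  - by subst a; rewrite (pendent_neighbour pv vw ab) !inE eqxx orbT.
  - by subst a; rewrite (pendent_neighbour pw wv ab) !inE eqxx.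
have := closed_connect clos (Gconn.2 v x).
by rewrite !inE eqxx => /esym/pred2P[] ->.
Qed.

(** Every vertex not sent to the centre is pendent, so [v] is sent to the centre and all other
    vertices have degree 1. *)
Lemma star_nonpendent_deg v : isomorphic G (star #|G|) -> ~~ pendent v ->
  deg v = max_deg G.
Proof.
case=> f f_bij f_adj npv; have [f' fK f'K] := f_bij.
have pendent_star w z : f w != 0 :> nat -> f z = 0 :> nat -> pendent w.
  move=> fw fz; apply/cards1P; exists z; apply/setP=> x.
  rewrite !inE -f_adj /= /star_adj (negPf fw) eq_sym eqbF_neg negbK.
  apply/eqP/eqP => [fx|-> //]; apply: (can_inj fK); apply: ord_inj.
  by rewrite fx fz.
have [z fz] : exists z, f z = 0 :> nat.
  have G_gt0 : (0 < #|G|)%N by case: Gconn.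
  by exists (f' (Ordinal G_gt0)); rewrite f'K.
have nonpendent_center w : ~~ pendent w -> w = z.
  move=> npw; apply: (can_inj fK); apply: ord_inj; rewrite fz.
  by apply/eqP; apply: contraNT npw => fw; apply: pendent_star fz.
apply/eqP; rewrite eqn_leq deg_le_max /=; apply/bigmax_leqP => w _.
have [pw|/nonpendent_center->] := boolP (pendent w); last by rewrite (nonpendent_center v).
rewrite (eqP pw) deg_gt0 //; apply: leq_trans (deg_le_max w).
by rewrite (eqP pw).
Qed.

(** Reduces the three graph families to one condition on degrees. Without pendent vertices this
    condition is regularity; otherwise the non-pendent and the pendent vertices are the two parts of
    a semiregular graph. *)
Lemma nonpendent_deg_max_iff :
  (forall v, ~~ pendent v -> deg v = max_deg G) <->
  [\/ isomorphic G (star #|G|), regular G | semiregular (max_deg G) 1 G].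
Proof.
split=> [nonpendent_deg | [star_G v | [k reg] v _ | [V1 [V2 [[VT _ _ _] [deg1 deg2]]]] v npv]].
- have [p0|[w pw]] := set_0Vmem [set v : G | pendent v].
    apply: Or32; exists (max_deg G) => v; apply: nonpendent_deg.
    by have := in_set0 v; rewrite -p0 inE => ->.
  have [w0 npw0] := Gnonpendent.
  apply: Or33; exists [set v : G | ~~ pendent v], [set v : G | pendent v].
  split; last by split=> v; rewrite inE; [apply: nonpendent_deg | move=> /eqP].
  split.
  + by apply/setP=> v; rewrite !inE orNb.
  + by rewrite disjoints_subset; apply/subsetP => v; rewrite !inE.
  + by apply/set0Pn; exists w0; rewrite inE.
  + by apply/set0Pn; exists w.
- exact: star_nonpendent_deg.
- apply/eqP; rewrite eqn_leq deg_le_max; apply/bigmax_leqP => w _.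
  by rewrite !reg.
- have : v \in [set: G] by rewrite inE.
  rewrite -VT inE => /orP[/deg1 // | /deg2 dv1].
  by rewrite /pendent dv1 in npv.
Qed.

Lemma min_nonpendent_deg_max :
  (forall v, ~~ pendent v -> deg v = max_deg G) -> min_nonpendent_deg G = max_deg G.
Proof.
move=> nonpendent_deg; have [v np <-] := min_nonpendent_deg_attained Gnonpendent.
exact: nonpendent_deg.
Qed.

Lemma max_deg_min_nonpendent :
  min_nonpendent_deg G = max_deg G -> forall v, ~~ pendent v -> deg v = max_deg G.
Proof.
move=> eq_min v npv; apply/eqP.
by rewrite eqn_leq deg_le_max -eq_min min_nonpendent_deg_le.
Qed.

(** * Edge-by-edge lower bound for AG, and the estimate of F *)

Section Weights.

Variable R : rcfType.

Local Notation m := (#|edges G|%:R : R).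
Local Notation Delta := ((max_deg G)%:R : R).
Local Notation delta1 := ((min_nonpendent_deg G)%:R : R).
Local Notation p := ((nb_pendent G)%:R : R).
Local Notation F := ((forgotten_index G)%:R : R).

Definition pendent_ends (u : G * G) : R := (pendent u.1)%:R + (pendent u.2)%:R.

Lemma sum_deg : \sum_(v : G) (deg v)%:R = 2 * m.
Proof.
by rewrite -[LHS](sum_edges (fun=> 1 : R)) sumr_const mulrnDl mulr_natl mulr2n.
Qed.

Lemma sum_pendent : \sum_(v : G) ((pendent v)%:R : R) = p.
Proof.
rewrite -natr_sum /nb_pendent -sum1_card [in RHS]big_mkcond; congr _%:R.
by apply: eq_bigr => v _; rewrite inE; case: pendent.
Qed.

(** A pendent vertex has degree 1, so it is counted at exactly one edge. *)
Lemma sum_pendent_ends : \sum_(u in edges G) pendent_ends u = p.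
Proof.
rewrite (sum_edges (fun v => (pendent v)%:R : R)) -sum_pendent.
by apply: eq_bigr => v _; have [/eqP->|_] := boolP (pendent v); rewrite ?mul0rn.
Qed.

Lemma pendent_ends_le1 u : u \in edges G -> pendent_ends u <= 1.
Proof.
rewrite inE => /andP[adj_u _]; rewrite /pendent_ends.
have := adj_not_both_pendent adj_u.
by do 2 case: pendent => //=; rewrite ?addr0 ?add0r // => /(_ isT).
Qed.

Lemma nb_pendent_le : p <= m.
Proof.
rewrite -sum_pendent_ends -[#|_|]sum1_card natr_sum.
by apply: ler_sum => u; apply: pendent_ends_le1.
Qed.

Lemma forgotten_index_le : F <= 2 * m * Delta ^+ 2 - p * (Delta ^+ 2 - 1).
Proof.
rewrite -sum_deg -sum_pendent !mulr_suml -sumrB natr_sum.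
apply: ler_sum => v _; rewrite natrX.
(* A pendent vertex gives equality, 1 = Delta^2 - (Delta^2 - 1); the others use d^3 <= d Delta^2. *)
have [/eqP->|_] := boolP (pendent v); first by rewrite expr1n !mul1r opprB addrC subrK.
have le_max : (deg v)%:R <= Delta by rewrite ler_nat deg_le_max.
rewrite mul0r subr0 exprS ler_wpM2l //.
by rewrite lerXn2r ?nnegrE.
Qed.

Lemma forgotten_index_eq : (forall v, ~~ pendent v -> deg v = max_deg G) ->
  F = 2 * m * Delta ^+ 2 - p * (Delta ^+ 2 - 1).
Proof.
move=> nonpendent_deg.
rewrite -sum_deg -sum_pendent !mulr_suml -sumrB natr_sum.
apply: eq_bigr => v _; rewrite natrX.
have [/eqP->|/nonpendent_deg->] := boolP (pendent v).
  by rewrite expr1n !mul1r opprB addrC subrK.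
by rewrite mul0r subr0 exprS.
Qed.

(* As at most one end of an edge is pendent, this is [pendent_weight delta1] on
   pendent edges and 1 on the others. *)
Definition edge_bound (u : G * G) : R :=
  1 + (pendent_weight delta1 - 1) * pendent_ends u.

Lemma sum_edge_bound :
  \sum_(u in edges G) edge_bound u = p * pendent_weight delta1 + (m - p).
Proof.
rewrite big_split /= -mulr_sumr sum_pendent_ends sumr_const; ring.
Qed.

Hypothesis max_gt0 : (0 < max_deg G)%N.

Lemma min_nonpendent_deg_gt1 : (1 < min_nonpendent_deg G)%N.
Proof.
have [v npv <-] := min_nonpendent_deg_attained Gnonpendent.
by rewrite ltn_neqAle eq_sym npv deg_gt0.
Qed.

Lemma edge_bound_cases v w : adj v w ->
  [\/ [/\ ~~ pendent v, pendent w, edge_bound (v, w) = pendent_weight delta1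
        & edge_weight (deg v)%:R (deg w)%:R = pendent_weight (deg v)%:R :> R],
      [/\ pendent v, ~~ pendent w, edge_bound (v, w) = pendent_weight delta1
        & edge_weight (deg v)%:R (deg w)%:R = pendent_weight (deg w)%:R :> R]
    | [/\ ~~ pendent v, ~~ pendent w & edge_bound (v, w) = 1]].
Proof.
move=> vw; have := adj_not_both_pendent vw.
rewrite /edge_bound /pendent_ends /=.
have degR_gt0 (x : G) : 0 < (deg x)%:R :> R by rewrite ltr0n deg_gt0.
have [pv|npv] := boolP (pendent v); have [pw|npw] := boolP (pendent w) => //= not_both.
- by have := not_both isT.
- apply: Or32; split => //; first by rewrite addr0 mulr1 addrC subrK.
  by rewrite edge_weightC (eqP pv) edge_weight1.
- apply: Or31; split => //; first by rewrite add0r mulr1 addrC subrK.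
  by rewrite (eqP pw) edge_weight1.
- by apply: Or33; split => //; rewrite addr0 mulr0 addr0.
Qed.

Lemma edge_bound_le v w : adj v w ->
  edge_bound (v, w) <= edge_weight (deg v)%:R (deg w)%:R.
Proof.
have delta_ge1 : 1 <= delta1 by rewrite ler1n ltnW // min_nonpendent_deg_gt1.
case/edge_bound_cases => [[np _ -> ->] | [_ np -> ->] | [_ _ ->]].
- by rewrite pendent_weight_le ?ler_nat ?min_nonpendent_deg_le.
- by rewrite pendent_weight_le ?ler_nat ?min_nonpendent_deg_le.
- by rewrite edge_weight_ge1 ?ltr0n ?deg_gt0.
Qed.

Lemma sum_edge_bound_le : p * pendent_weight delta1 + (m - p) <= AG R G.
Proof.
rewrite -sum_edge_bound; apply: ler_sum => -[v w]; rewrite inE => /andP[vw _].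
exact: edge_bound_le.
Qed.

(** A larger degree at [v] would push the edge weight strictly above its bound, [pendent_weight]
    being strictly increasing on [1, oo). *)
Lemma pendent_edge_weight_eq v w : ~~ pendent v -> pendent w -> adj v w ->
  edge_weight (deg v)%:R (deg w)%:R = edge_bound (v, w) ->
  deg v = min_nonpendent_deg G.
Proof.
move=> npv pw /edge_bound_cases[[_ _ -> ->] | [pv] | [_]]; last 2 first.
- by rewrite pv in npv.
- by rewrite pw.
move=> eq_weight; apply/eqP; rewrite eqn_leq min_nonpendent_deg_le // andbT leqNgt.
apply/negP => lt_deg; suff : pendent_weight delta1 < pendent_weight (deg v)%:R.
  by rewrite eq_weight ltxx.
by rewrite pendent_weight_lt ?ler1n ?ltr_nat // ltnW ?min_nonpendent_deg_gt1.
Qed.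

Lemma all_edges_pendent_eq :
  m = p -> AG R G = p * pendent_weight delta1 + (m - p) ->
  min_nonpendent_deg G = max_deg G.
Proof.
move=> eq_mp eqAG.
(* The nonnegative terms [1 - pendent_ends u] sum to m - p = 0, so each vanishes. The same argument
   applied to the gaps between weight and bound then makes every edge attain its bound. *)
have edge_pendent u : u \in edges G -> pendent u.1 || pendent u.2.
  move=> u_edge; have sum0 : \sum_(u in edges G) (1 - pendent_ends u) = 0.
    by rewrite sumrB sum_pendent_ends sumr_const eq_mp subrr.
  have ge0 e : e \in edges G -> 0 <= 1 - pendent_ends e.
    by rewrite subr_ge0; apply: pendent_ends_le1.
  have /eqP := psumr_eq0P ge0 sum0 u_edge.
  apply: contraTT; rewrite negb_or /pendent_ends => /andP[/negPf-> /negPf->].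
  by rewrite addr0 subr0 oner_neq0.
have edge_eq u : u \in edges G ->
    edge_weight (deg u.1)%:R (deg u.2)%:R = edge_bound u.
  move=> u_edge; apply/eqP; rewrite -subr_eq0; apply/eqP.
  pose gap e := edge_weight (deg e.1)%:R (deg e.2)%:R - edge_bound e.
  have gap_ge0 e : e \in edges G -> 0 <= gap e.
    by case: e => v w; rewrite inE => /andP[vw _]; rewrite subr_ge0 edge_bound_le.
  apply: (psumr_eq0P gap_ge0 _ u_edge).
  by rewrite sumrB sum_edge_bound -eqAG subrr.
have nonpendent_deg v : ~~ pendent v -> deg v = min_nonpendent_deg G.
  move=> npv; have /deg_gt0P[w vw] := deg_gt0 v max_gt0.
  (* Only one orientation of the edge lies in [edges]; both the weight and the bound are symmetric
     in the ends. *)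
  have /orP[e|e] := mem_edges vw.
    have := edge_pendent _ e; rewrite /= (negPf npv) /= => pw.
    exact: pendent_edge_weight_eq pw vw (edge_eq _ e).
  have := edge_pendent _ e; rewrite /= (negPf npv) orbF => pw.
  apply: (pendent_edge_weight_eq npv pw vw).
  by rewrite edge_weightC (edge_eq _ e) /edge_bound /pendent_ends [X in _ * X]addrC.
(* A vertex of maximum degree is not pendent: otherwise the maximum degree would be 1, while
   non-pendent degrees exceed 1. *)
have [v maxv] := @bigop.eq_bigmax G (@deg G) Gconn.1.
rewrite /max_deg maxv nonpendent_deg //; apply/negP => pv.
have [x npx] := Gnonpendent; have := min_nonpendent_deg_gt1.
by rewrite -(nonpendent_deg x npx) ltnNge -(eqP pv) -maxv deg_le_max.
Qed.

(** Each edge attains its bound: here delta1 = Delta, which settles the pendent edges, and any other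
    edge joins two vertices of equal degree. *)
Lemma AG_diag : (forall v, ~~ pendent v -> deg v = max_deg G) ->
  AG R G = p * pendent_weight delta1 + (m - p).
Proof.
move=> nonpendent_deg; rewrite -sum_edge_bound; apply: eq_bigr => -[v w].
rewrite inE /= => /andP[vw _].
rewrite -/(edge_weight (deg v)%:R (deg w)%:R).
have Dgt0 : 0 < Delta by rewrite ltr0n.
case: (edge_bound_cases vw) => [[np _ -> ->] | [_ np -> ->] | [npv npw ->]].
- by rewrite (min_nonpendent_deg_max nonpendent_deg) nonpendent_deg.
- by rewrite (min_nonpendent_deg_max nonpendent_deg) nonpendent_deg.
- by rewrite !nonpendent_deg ?edge_weight_diag.
Qed.

End Weights.

End Graphs.

Theorem theorem4 (R : rcfType) (G : sgraph) (n : nat)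
    (m Delta delta1 p F : R)
    (Gconn : connected G)
    (Gnonpendent : exists v : G, ~~ pendent v)
    (def_n : n = #|G|)
    (def_m : m = #|edges G|%:R)
    (def_Delta : Delta = (max_deg G)%:R)
    (def_delta1 : delta1 = (min_nonpendent_deg G)%:R)
    (def_p : p = (nb_pendent G)%:R)
    (def_F : F = (forgotten_index G)%:R) :
  let rhs : R :=
    p * (delta1 + 1) / (2 * Num.sqrt delta1)
    + Num.sqrt (2 * (m - p) * (Delta + delta1) * Num.sqrt (Delta * delta1))
        / (Delta * (Delta + delta1 + 2 * Num.sqrt (Delta * delta1)))
      * Num.sqrt (F + 2 * m * Delta ^+ 2 - p * (3 * Delta ^+ 2 + 1)) in
  rhs <= AG R G /\
  (AG R G = rhs <->
    [\/ isomorphic G (star n), regular G | semiregular (max_deg G) 1 G]).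
Proof.
move=> rhs.
have rhsE : rhs = p * pendent_weight delta1
    + core_bound Delta delta1 (m - p) (F + 2 * m * Delta ^+ 2 - p * (3 * Delta ^+ 2 + 1)).
  by rewrite /rhs /core_bound /pendent_weight mulrA.
rewrite def_n -nonpendent_deg_max_iff //.
(* Without edges, m = p = 0. The denominators of the bound vanish, but so do the numerators, and
   both sides are 0. All degrees are then 0, so the degree condition holds as well. *)
have [max0|max_gt0] := posnP (max_deg G).
  have no_edge : edges G = set0.
    apply/setP=> -[v w]; rewrite !inE; apply/negP => /andP[/= vw _].
    by have := leq_trans (introT (deg_gt0P v) (ex_intro _ w vw)) (deg_le_max v); rewrite max0.
  have m0 : m = 0 by rewrite def_m no_edge cards0.
  have p0 : p = 0.
    by apply/le_anti; rewrite -{1}m0 {1}def_p def_m nb_pendent_le //= def_p ler0n.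
  have -> : rhs = 0.
    by rewrite rhsE /core_bound p0 m0 subr0 mulr0 !mul0r sqrtr0 !mul0r addr0.
  rewrite /AG no_edge big_set0; split=> //; split=> // _ v _.
  by apply/eqP; rewrite eqn_leq deg_le_max max0.
have Delta_gt0 : 0 < Delta by rewrite def_Delta ltr0n.
have delta_ge0 : 0 <= delta1 by rewrite def_delta1.
have M_ge0 : 0 <= m - p by rewrite subr_ge0 def_m def_p nb_pendent_le.
(* The constants in the radicand are such that -(Delta^2 - 1) - (3 Delta^2 + 1) = -4 Delta^2. *)
have leK : F + 2 * m * Delta ^+ 2 - p * (3 * Delta ^+ 2 + 1) <= 4 * Delta ^+ 2 * (m - p).
  have := forgotten_index_le G R; rewrite -def_m -def_p -def_Delta -def_F; lra.
have le_AG : p * pendent_weight delta1 + (m - p) <= AG R G.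
  by rewrite def_p def_m def_delta1 sum_edge_bound_le.
have le_core := core_bound_le Delta_gt0 delta_ge0 M_ge0 leK.
split; first by rewrite rhsE; lra.
split=> [|nonpendent_deg].
  rewrite rhsE => eqAG; apply: max_deg_min_nonpendent.
  (* The quantity p h(delta1) + (m - p) lies between [rhs] and [AG R G], so their equality makes the
     second summand exactly m - p. *)
  have eq_core : core_bound Delta delta1 (m - p)
      (F + 2 * m * Delta ^+ 2 - p * (3 * Delta ^+ 2 + 1)) = m - p by lra.
  have [M_gt0|M_le0] := ltP 0 (m - p).
    have /eqP := core_bound_eq Delta_gt0 delta_ge0 M_gt0 leK eq_core.
    by rewrite def_delta1 def_Delta eqr_nat => /eqP.
  apply: (@all_edges_pendent_eq _ Gconn Gnonpendent R) => //.
    by rewrite -def_m -def_p; lra.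
  by rewrite -def_m -def_p -def_delta1; lra.
rewrite rhsE.
have -> : F + 2 * m * Delta ^+ 2 - p * (3 * Delta ^+ 2 + 1) = 4 * Delta ^+ 2 * (m - p).
  have := forgotten_index_eq R nonpendent_deg; rewrite -def_m -def_p -def_Delta -def_F => ->.
  ring.
have -> : core_bound Delta delta1 (m - p) (4 * Delta ^+ 2 * (m - p)) = m - p.
  by rewrite def_delta1 min_nonpendent_deg_max // -def_Delta core_bound_diag.
by rewrite AG_diag // -def_m -def_p -def_delta1.
Qed.
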